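(* Let $a>b>0$ and $\delta\in(0,1)$ be constants with $a+b>4$, and let $p=a\log n/n$, $q=b\log n/n$. Given $(\sigma,\ell)\in\mathfrak C(\delta)$, let $A$ be drawn from $\mathrm{PL\text{-}SBM}(p,q,\sigma,\ell)$. Then, as $n\to\infty$, the simple voting estimator $\hat\sigma_S$ satisfies $$\mathbb E\left[r(\hat\sigma_S)\right]\le n^{-(1+o(1))\,\delta(\sqrt a-\sqrt b)^2/2}.$$
   Context: Balanced partitions and partial labels. Let $\mathcal V=[n]$, with $n$ even and $\delta n/2$ an integer. A partition map is $\sigma:\mathcal V\to\{-1,1\}$, with communities $\mathcal C_+=\sigma^{-1}(1)$, $\mathcal C_-=\sigma^{-1}(-1)$. Partial labels are a map $\ell:\mathcal V\to\{-1,0,1\}$ with $\ell(v)=\sigma(v)$ whenever $\ell(v)\ne0$. Put $\mathcal R_+=\ell^{-1}(1)$, $\mathcal R_-=\ell^{-1}(-1)$ (revealed sets) and $\mathcal U=\ell^{-1}(0)$ (unrevealed set). Write $(\sigma,\ell)\in\mathfrak C(\delta)$ if $|\mathcal C_+|=|\mathcal C_-|=n/2$ and $|\mathcal R_+|=|\mathcal R_-|=\delta n/2$. Model. For fixed $(\sigma,\ell)\in\mathfrak C(\delta)$, $\mathrm{PL\text{-}SBM}(p,q,\sigma,\ell)$ is the law of a random symmetric matrix $A\in\{0,1\}^{n\times n}$ whose entries $A(u,v)$, $u\le v$, are independent, with $A(u,v)\sim$ Bernoulli$(p)$ if $\sigma(u)=\sigma(v)$ (including $u=v$) and Bernoulli$(q)$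 if $\sigma(u)\neq\sigma(v)$. Simple voting. For $u\in\mathcal U$, $S(u)=\sum_{v\in\mathcal R_+}A(u,v)-\sum_{v\in\mathcal R_-}A(u,v)$ and $\hat\sigma_S(u)=\mathrm{Sgn}(S(u))$, where $\mathrm{Sgn}$ is the sign function with $\mathrm{Sgn}(0)=0$. Error rate. $r(\hat\sigma)=\frac1{|\mathcal U|}\sum_{v\in\mathcal U}\mathbf 1\{\hat\sigma(v)\neq\sigma(v)\}$; the expectation is over $A$ with $(\sigma,\ell)$ fixed. *)

(* Defs.v *)
From HB Require Import structures.
From mathcomp Require Import all_boot all_order all_algebra.
From mathcomp Require Import all_classical all_reals all_analysis.

Set Implicit Arguments.
Unset Strict Implicit.
Unset Printing Implicit Defensive.

Import Order.TTheory GRing.Theory Num.Theory.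
Import numFieldNormedType.Exports.

Local Open Scope classical_set_scope.
Local Open Scope ring_scope.

Definition partition_map (n : nat) (sigma : 'I_n -> int) : Prop :=
  forall v, sigma v = 1 \/ sigma v = -1.

Definition partial_labels (n : nat) (sigma ell : 'I_n -> int) : Prop :=
  forall v, (ell v = 1 \/ ell v = 0 \/ ell v = -1) /\
            (ell v != 0 -> ell v = sigma v).

(* Level sets: [fiber sigma s] is the community C_s; [fiber ell s] is the
   revealed set R_s for s = 1, -1 and the unrevealed set U for s = 0. *)
Definition fiber (n : nat) (f : 'I_n -> int) (s : int) : {set 'I_n} :=
  [set v | f v == s]%SET.

(* The cardinality equations hold in R, with exact division: they force n to
   be even and delta * n / 2 to be an integer. *)
Definition balanced_labeling (R : realType) (delta : R) (n : nat)
    (sigma ell : 'I_n -> int) : Prop :=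
  [/\ partition_map sigma, partial_labels sigma ell,
      #|fiber sigma 1|%:R = n%:R / 2 :> R /\
      #|fiber sigma (-1)|%:R = n%:R / 2 :> R
    & #|fiber ell 1|%:R = delta * n%:R / 2 :> R /\
      #|fiber ell (-1)|%:R = delta * n%:R / 2 :> R].

(* Product rule over every finite subfamily of (X_i), i in D. *)
Definition mutually_independent (d d' : measure_display)
    (T : measurableType d) (T' : measurableType d') (R : realType)
    (P : probability T R) (I : finType) (D : {set I}) (X : I -> T -> T')
    : Prop :=
  forall (J : {set I}) (B : I -> set T'),
    J \subset D -> (forall i, measurable (B i)) ->
    P (\bigcap_(i in [set` J]) (X i @^-1` B i)) =
    (\prod_(i in J) P (X i @^-1` B i))%E.

(* The random matrix A on (T, P) has law PL-SBM(p, q, sigma, ell). This law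
   does not depend on ell. For a parameter outside [0, 1], [bernoulli_prob]
   is by convention the Dirac mass at false. *)
Definition PL_SBM (d : measure_display) (T : measurableType d) (R : realType)
    (P : probability T R) (p q : R) (n : nat) (sigma : 'I_n -> int)
    (A : T -> 'M[bool]_n) : Prop :=
  [/\ forall w, (A w)^T = A w,
      forall u v, measurable_fun [set: T] (fun w => A w u v),
      forall u v, pushforward P (fun w => A w u v) =
        bernoulli_prob (if sigma u == sigma v then p else q)
    & mutually_independent P [set uv : 'I_n * 'I_n | (uv.1 <= uv.2)%N]%SET
        (fun uv w => A w uv.1 uv.2)].

Definition voting_score (n : nat) (ell : 'I_n -> int) (A : 'M[bool]_n)
    (u : 'I_n) : int :=
  \sum_(v in fiber ell 1) (A u v : nat)%:Z -
  \sum_(v in fiber ell (-1)) (A u v : nat)%:Z.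

Definition simple_voting (n : nat) (ell : 'I_n -> int) (A : 'M[bool]_n)
    (u : 'I_n) : int :=
  Num.sg (voting_score ell A u).

Definition error_rate (R : realType) (n : nat) (sigma ell : 'I_n -> int)
    (sigma_hat : 'I_n -> int) : R :=
  #|fiber ell 0|%:R^-1 * \sum_(v in fiber ell 0) (sigma_hat v != sigma v)%:R.

(* Main.v *)
Require Import Defs.
From HB Require Import structures.
From mathcomp Require Import all_boot all_order all_algebra.
From mathcomp Require Import all_classical all_reals all_analysis.
From mathcomp Require Import measurable_realfun.
From mathcomp Require Import ring lra.

Set Implicit Arguments.
Unset Strict Implicit.
Unset Printing Implicit Defensive.

Import Order.TTheory GRing.Theory Num.Theory.
Import numFieldNormedType.Exports.

Local Open Scope classical_set_scope.
Local Open Scope ring_scope.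

(** The bound holds with exponent exactly [delta (sqrt a - sqrt b)^2 / 2] as
soon as [p] and [q] lie in [[0, 1]], so the error term can be taken to be zero.

By linearity the expected error rate is the average over unrevealed vertices
[u] of the probability that [u] is misclassified
([expectation_error_rate_le]).  The sign of the score of [u] differs from
[sigma u] only if the score, multiplied by [sigma u], is nonpositive.  That
product is a sum of [m = delta n / 2] entries of law Bernoulli(p), from the
revealed vertices of the community of [u], minus a sum of [m] entries of law
Bernoulli(q), all independent; so this is a large deviation event.  Chernoff's
bound with parameter [t], in which [1 + x <= exp x] bounds the moment
generating function of each entry, gives for its probability the upper bound
([PL_SBM_chernoff], [vote_exponent])
[exp (m (p (exp (- t) - 1) + q (exp t - 1)))].
The exponent is minimal at [exp t = sqrt (p / q) = sqrt (a / b)], where it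
equals [- m (sqrt p - sqrt q)^2], that is
[- (delta / 2) (sqrt a - sqrt b)^2 ln n] ([voting_exponent_opt]).

Only finitely many events are determined by row [u] of the matrix, so the
exponential moment is a finite sum over the possible values of that row:
independence gives the probability of each value as a product
([PL_SBM_row]), and the sum of products factors into a product of sums. *)

(** * Events determined by a finite-valued random variable *)

Lemma measurable_fin_preimage (d : measure_display) (T : measurableType d)
    (F : finType) (X : T -> F) (Q : pred F) :
  (forall f, measurable [set w | X w = f]) -> measurable [set w | Q (X w)].
Proof.
move=> mX.
have -> : [set w | Q (X w)] = \bigcup_(f in [set` Q]) [set w | X w = f].
  by apply/seteqP; split => w /=; [move=> QX; exists (X w) | move=> [f Qf ->]].
by apply: fin_bigcup_measurable => // f _; exact: mX.
Qed.

Lemma probability_fin_preimage (d : measure_display) (T : measurableType d)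
    (R : realType) (P : probability T R) (F : finType) (X : T -> F)
    (Q : pred F) :
  (forall f, measurable [set w | X w = f]) ->
  P [set w | Q (X w)] = (\sum_(f | Q f) P [set w | X w = f])%E.
Proof.
move=> mX.
have -> : [set w | Q (X w)] = \bigcup_(f in [set` Q]) [set w | X w = f].
  by apply/seteqP; split => w /=; [move=> QX; exists (X w) | move=> [f Qf ->]].
rewrite measure_fin_bigcup//; last by move=> f g _ _ [w [/= <- <-]].
apply/esym/bigfs; first exact: index_enum_uniq.
by move=> f _; rewrite mem_index_enum.
Qed.

(** * The law of a row of the adjacency matrix *)

Lemma PL_SBM_entry (d : measure_display) (T : measurableType d) (R : realType)
    (P : probability T R) (p q : R) (n : nat) (sigma : 'I_n -> int)
    (A : T -> 'M[bool]_n) (u v : 'I_n) (b : bool) :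
  0 <= p <= 1 -> 0 <= q <= 1 -> PL_SBM P p q sigma A ->
  P [set w | A w u v = b] =
  (bernoulli_pmf (if sigma u == sigma v then p else q) b)%:E.
Proof.
move=> p01 q01 [_ _ /(_ u v) lawA _].
have -> : P [set w | A w u v = b] = pushforward P (fun w => A w u v) [set b].
  by [].
rewrite lawA bernoulli_probE; last by case: ifP.
by rewrite !diracE !in_set1 /bernoulli_pmf /unstable.onem; case: b;
  rewrite /= ?mule1 ?mule0 ?adde0 ?add0e.
Qed.

(** Independence concerns the entries on or above the diagonal, while row [u]
crosses the diagonal.  By symmetry its entry in column [v] is the one at
[h v], the sorted pair of [u] and [v]; [h] is injective because [g] recovers
[v] from it, so the row is a subfamily of the independent entries. *)
Lemma PL_SBM_row (d : measure_display) (T : measurableType d) (R : realType)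
    (P : probability T R) (p q : R) (n : nat) (sigma : 'I_n -> int)
    (A : T -> 'M[bool]_n) (u : 'I_n) (f : {ffun 'I_n -> bool}) :
  0 <= p <= 1 -> 0 <= q <= 1 -> PL_SBM P p q sigma A ->
  P [set w | [ffun v => A w u v] = f] =
  (\prod_v bernoulli_pmf (if sigma u == sigma v then p else q) (f v))%:E.
Proof.
move=> p01 q01 sbmA; have [symA _ _ indA] := sbmA.
have symE w x y : A w x y = A w y x by rewrite -{1}(symA w) mxE.
pose h (v : 'I_n) := if (u <= v)%N then (u, v) else (v, u).
pose g (xy : 'I_n * 'I_n) := if xy.1 == u then xy.2 else xy.1.
have hK : cancel h g.
  move=> v; rewrite /h /g; case: leqP => //= uv; first by rewrite eqxx.
  by case: eqVneq => // vu; rewrite vu ltnn in uv.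
have Ah w v : A w (h v).1 (h v).2 = A w u v.
  by rewrite /h; case: leqP => //= _; exact: symE.
have -> : [set w | [ffun v => A w u v] = f] =
    \bigcap_(xy in [set` [set h v | v in 'I_n]%SET])
      ((fun w => A w xy.1 xy.2) @^-1` [set f (g xy)]).
  apply/seteqP; split => w /=.
    by move=> rowf xy /imsetP[v _ ->]; rewrite /= Ah hK -rowf ffunE.
  move=> H; apply/ffunP => v; rewrite ffunE -Ah -[in RHS](hK v).
  by apply: H; apply/imsetP; exists v.
rewrite (indA _ (fun xy => [set f (g xy)])); last 2 first.
- apply/fintype.subsetP => xy /imsetP[v _ ->]; rewrite inE /h.
  by case: ifP => /= [//|/negbT]; rewrite -ltnNge => /ltnW.
- by [].
rewrite big_imset /=; last by move=> x y _ _; exact: (can_inj hK).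
rewrite -prodEFin; apply: eq_bigr => v _; rewrite hK.
rewrite -(PL_SBM_entry u v (f v) p01 q01 sbmA); congr (P _).
by apply/seteqP; split=> w /=; rewrite Ah.
Qed.


Lemma measurable_row_fiber (d : measure_display) (T : measurableType d)
    (n : nat) (A : T -> 'M[bool]_n) (u : 'I_n) (f : {ffun 'I_n -> bool}) :
  (forall v, measurable_fun [set: T] (fun w => A w u v)) ->
  measurable [set w | [ffun v => A w u v] = f].
Proof.
move=> mA.
have -> : [set w | [ffun v => A w u v] = f] =
    \bigcap_(v in [set: 'I_n]) ((fun w => A w u v) @^-1` [set f v]).
  apply/seteqP; split => w /=.
    by move=> <- v _; rewrite /= ffunE.
  by move=> H; apply/ffunP => v; rewrite ffunE H.
apply: fin_bigcap_measurable; first exact: finite_finset.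
by move=> v _; rewrite -[X in measurable X]setTI; exact: mA.
Qed.

(** A row is an arbitrary function on ['I_n] here, so that events about voting
scores are instances by conversion. *)
Lemma measurable_row_event (d : measure_display) (T : measurableType d)
    (n : nat) (A : T -> 'M[bool]_n) (u : 'I_n) (Q : pred ('I_n -> bool)) :
  (forall v, measurable_fun [set: T] (fun w => A w u v)) ->
  measurable [set w | Q (A w u)].
Proof.
move=> mA.
have -> : [set w | Q (A w u)] =
    [set w | Q (fun v => [ffun v => A w u v] v)].
  apply/funext => w /=; congr (is_true (Q _)).
  by apply/funext => v; rewrite ffunE.
apply: (@measurable_fin_preimage _ _ _ (fun w => [ffun v => A w u v])
  (fun f : {ffun 'I_n -> bool} => Q f)) => f.
exact: measurable_row_fiber.
Qed.

(** * Large deviations of the voting score *)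

(** The indicator of a nonnegative weighted sum is at most the exponential of
the sum.  The expectation of this exponential is the product over [v] of
[1 + r v * (expR (c v) - 1)], where [r v] is the probability of an edge
between [u] and [v], and [1 + x <= expR x] bounds each factor.
Weights [c v = 0] restrict the sum to a part of the row at no cost. *)
Lemma PL_SBM_chernoff (d : measure_display) (T : measurableType d)
    (R : realType) (P : probability T R) (p q : R) (n : nat)
    (sigma : 'I_n -> int) (A : T -> 'M[bool]_n) (u : 'I_n) (c : 'I_n -> R) :
  0 <= p <= 1 -> 0 <= q <= 1 -> PL_SBM P p q sigma A ->
  (P [set w | (0 <= \sum_v c v * (A w u v)%:R)%R] <=
   (expR (\sum_v (if sigma u == sigma v then p else q) *
                 (expR (c v) - 1)))%:E)%E.
Proof.
move=> p01 q01 sbmA; have [_ mA _ _] := sbmA.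
set r := fun v => if sigma u == sigma v then p else q.
have r01 v : 0 <= r v <= 1 by rewrite /r; case: ifP.
pose Q (f : {ffun 'I_n -> bool}) := 0 <= \sum_v c v * (f v)%:R.
have -> : [set w | 0 <= \sum_v c v * (A w u v)%:R] =
    [set w | Q [ffun v => A w u v]].
  apply/funext => w /=; congr (is_true (0 <= _)).
  by apply: eq_bigr => v _; rewrite ffunE.
rewrite (probability_fin_preimage P); last first.
  by move=> f; exact: measurable_row_fiber.
under eq_bigr do rewrite (PL_SBM_row u _ p01 q01 sbmA).
rewrite sumEFin lee_fin.
have pmf_ge0 (f : {ffun 'I_n -> bool}) v : 0 <= bernoulli_pmf (r v) (f v).
  have /andP[r0 r1] := r01 v.
  by rewrite /bernoulli_pmf; case: ifP; rewrite ?subr_ge0.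
have -> : expR (\sum_v r v * (expR (c v) - 1)) =
    \prod_v expR (r v * (expR (c v) - 1)) by rewrite expR_sum.
apply: (@le_trans _ _ (\sum_(f : {ffun 'I_n -> bool})
    \prod_v (bernoulli_pmf (r v) (f v) * expR (c v * (f v)%:R)))).
  rewrite big_mkcond /=; apply: ler_sum => f _; rewrite big_split /= -expR_sum.
  have prod0 : 0 <= \prod_v bernoulli_pmf (r v) (f v) by exact: prodr_ge0.
  case: ifP => Qf; last by rewrite mulr_ge0 ?expR_ge0.
  by rewrite ler_peMr //  -[leLHS]expR0 ler_expR.
(* The sum over all rows of a product over columns is a product of sums. *)
rewrite -(bigA_distr_bigA (fun v b =>
  bernoulli_pmf (r v) b * expR (c v * (b : bool)%:R))) /=.
apply: ler_prod => v _; rewrite big_bool /= mulr1 mulr0 expR0 mulr1.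
have /andP[r0 r1] := r01 v.
apply/andP; split; first by rewrite addr_ge0 ?subr_ge0 ?mulr_ge0 ?expR_ge0.
apply: le_trans (expR_ge1Dx _).
by rewrite mulrBr mulr1 addrCA.
Qed.

(** A wrong vote, a tie included, means [sigma u * S <= 0] for the score
[S = \sum_v ell v * M u v]; the weights are those of [- t * sigma u * S]. *)
Lemma misvote_weighted_sum (R : realDomainType) (n : nat)
    (sigma ell : 'I_n -> int) (M : 'M[bool]_n) (u : 'I_n) (t : R) :
  partition_map sigma -> partial_labels sigma ell -> 0 <= t ->
  simple_voting ell M u != sigma u ->
  0 <= \sum_v (- (t * (sigma u * ell v)%:~R)) * (M u v)%:R.
Proof.
move=> sP lP t0; rewrite /simple_voting => Sne.
have scoreE : voting_score ell M u = \sum_v ell v * (M u v : nat)%:Z.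
  rewrite /voting_score big_mkcond /= [X in _ - X]big_mkcond -sumrB.
  apply: eq_bigr => v _; rewrite !inE.
  have [[->|[->|->]] _] := lP v;
  by rewrite /= ?subr0 ?mul1r ?mul0r ?sub0r ?mulN1r.
have -> : \sum_v (- (t * (sigma u * ell v)%:~R)) * (M u v)%:R =
    t * (- (sigma u * voting_score ell M u))%:~R.
  rewrite scoreE mulr_sumr -sumrN rmorph_sum mulr_sumr.
  apply: eq_bigr => v _.
  by rewrite !rmorphN !rmorphM /= mulrN mulNr mulrA !mulrA.
rewrite mulr_ge0// ler0z oppr_ge0.
move: Sne; have [->|->] := sP u; rewrite ?mul1r ?mulN1r ?oppr_le0.
- by case: sgrP.
- by case: sgrP.
Qed.

(** Since [ell v] is [0] or [sigma v], a vertex revealed with the label of [u]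
has edge probability [p] and weight [- t], one revealed with the opposite
label has edge probability [q] and weight [t], and the others contribute
nothing. *)
Lemma vote_exponent (R : realType) (n : nat) (sigma ell : 'I_n -> int)
    (u : 'I_n) (m p q t : R) :
  partition_map sigma -> partial_labels sigma ell ->
  #|fiber ell 1|%:R = m -> #|fiber ell (-1)|%:R = m ->
  \sum_v (if sigma u == sigma v then p else q) *
    (expR (- (t * (sigma u * ell v)%:~R)) - 1) =
  m * (p * (expR (- t) - 1) + q * (expR t - 1)).
Proof.
move=> sP lP m1 mN1.
have -> : \sum_v (if sigma u == sigma v then p else q) *
      (expR (- (t * (sigma u * ell v)%:~R)) - 1) =
    \sum_(v in fiber ell (sigma u)) p * (expR (- t) - 1) +
    \sum_(v in fiber ell (- sigma u)) q * (expR t - 1).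
  rewrite [X in _ = X + _]big_mkcond [X in _ = _ + X]big_mkcond -big_split /=.
  apply: eq_bigr => v _; rewrite !inE.
  have [ell3 ellE] := lP v.
  case: (eqVneq (ell v) 0) => [->|ellv].
    rewrite mulr0 mulr0z mulr0 oppr0 expR0 subrr mulr0.
    by have [->|->] := sP u; rewrite /= addr0.
  rewrite -(ellE ellv); move: ellv.
  case: ell3 => [->|[->|->]] // _; have [->|->] := sP u.
  - by rewrite mulr1 mulr1z mulr1 /= addr0.
  - by rewrite mulN1r mulrN1z mulrN1 opprK /= add0r.
  - by rewrite mul1r mulrN1z mulrN1 opprK /= add0r.
  - by rewrite mulrN1 opprK mulr1z mulr1 /= addr0.
rewrite !sumr_const -(mulr_natl (p * _)) -(mulr_natl (q * _)).
by have [->|->] := sP u; rewrite ?opprK m1 mN1 [RHS]mulrDr.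
Qed.

(** With [s = sqrt n], [ln n = 2 ln s <= 2 s], so that [c ln n <= s ^+ 2] once
[2 c <= s]. *)
Lemma log_rate_le1 (R : realType) (c : R) : 0 <= c ->
  \forall n \near \oo, 0 <= c * ln n%:R / n%:R <= 1.
Proof.
move=> c0; near=> n.
have n1 : 1 <= n%:R :> R by near: n; exact: nbhs_infty_ger.
have n4 : (2 * c) ^+ 2 <= n%:R :> R by near: n; exact: nbhs_infty_ger.
have n0 : 0 < n%:R :> R by exact: lt_le_trans n1.
apply/andP; split; first by rewrite divr_ge0 ?mulr_ge0 ?ln_ge0 // ltW.
rewrite ler_pdivrMr // mul1r.
set s := Num.sqrt (n%:R : R).
have s0 : 0 < s by rewrite sqrtr_gt0.
have nE : n%:R = s ^+ 2 :> R by rewrite sqr_sqrtr // ltW.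
have cs : 2 * c <= s by rewrite -(@ler_pXn2r _ 2) // ?nnegrE -?nE // ?mulr_ge0 // ltW.
have lns := ltW (ln_sublinear s0).
rewrite nE lnXn // -mulr_natr; nra.
Unshelve. all: by end_near. Qed.

(** The value of [t] is the minimizer [ln (sqrt (a / b))] of the Chernoff
exponent; the bracket then becomes the negative of a square because
[a * sqrt (b / a) + b * sqrt (a / b) = 2 * sqrt (a * b)]. *)
Lemma voting_exponent_opt (R : realType) (a b L N delta : R) :
  0 < b -> 0 < a -> 0 < N ->
  let t := ln (Num.sqrt a / Num.sqrt b) in
  delta * N / 2 * (a * L / N * (expR (- t) - 1) + b * L / N * (expR t - 1)) =
  - (delta * (Num.sqrt a - Num.sqrt b) ^+ 2 / 2) * L.
Proof.
move=> b0 a0 N0 t.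
have sa0 : 0 < Num.sqrt a by rewrite sqrtr_gt0.
have sb0 : 0 < Num.sqrt b by rewrite sqrtr_gt0.
rewrite expRN /t lnK ?posrE ?divr_gt0 //.
have aE : a = Num.sqrt a ^+ 2 by rewrite sqr_sqrtr // ltW.
have bE : b = Num.sqrt b ^+ 2 by rewrite sqr_sqrtr // ltW.
rewrite {1}aE {2}bE.
by field; rewrite !gt_eqF.
Qed.

(** * From one vertex to the error rate *)

(** The condition [0 <= eps] covers an empty unrevealed set, for which the
error rate is [0^-1 * 0 = 0]. *)
Lemma expectation_error_rate_le (d : measure_display) (T : measurableType d)
    (R : realType) (P : probability T R) (n : nat) (sigma ell : 'I_n -> int)
    (X : T -> 'I_n -> int) (eps : R) :
  0 <= eps -> (forall v, measurable [set w | X w v != sigma v]) ->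
  (forall v, ell v = 0 -> (P [set w | X w v != sigma v] <= eps%:E)%E) ->
  ('E_P [fun w => error_rate R sigma ell (X w)] <= eps%:E)%E.
Proof.
move=> eps0 mX PX; rewrite unlock.
set U := fiber ell 0.
pose E v := [set w | X w v != sigma v].
have rateE w : (error_rate R sigma ell (X w))%:E =
    (#|U|%:R^-1%:E * \sum_(v <- enum U) (\1_(E v) w)%:E)%E.
  rewrite /error_rate -/U EFinM -sumEFin big_enum /=; congr (_ * _)%E.
  apply: eq_bigr => v _; rewrite indicE; congr (nat_of_bool _)%:R%:E.
  by apply/idP/idP; rewrite inE.
have mE v : measurable_fun [set: T] (fun w => (\1_(E v) w)%:E : \bar R).
  by apply/measurable_EFinP/measurable_indic; exact: mX.
under eq_integral do rewrite rateE.
rewrite ge0_integralZl_EFin ?invr_ge0 ?ler0n //; last 2 first.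
- by move=> w _; apply: sume_ge0 => v _; rewrite lee_fin.
- exact: emeasurable_sum.
rewrite ge0_integral_sum //.
have intE v : (\int[P]_w (\1_(E v) w)%:E = P (E v))%E.
  by rewrite integral_indic ?setIT; last exact: mX.
under eq_bigr do rewrite intE.
rewrite big_enum /=.
apply: (@le_trans _ _ (#|U|%:R^-1%:E * \sum_(v in U) eps%:E)%E).
  apply: lee_wpmul2l; first by rewrite lee_fin invr_ge0.
  by apply: lee_sum => v; rewrite inE => /eqP; exact: PX.
rewrite sumEFin -EFinM lee_fin sumr_const.
have [->|U0] := posnP #|U|; first by rewrite invr0 mul0r.
by rewrite -(mulr_natl eps) mulKf // pnatr_eq0 -lt0n.
Qed.

Theorem theorem3 (R : realType) (a b delta : R)
  (hb : 0 < b) (hab : b < a) (hdelta0 : 0 < delta) (hdelta1 : delta < 1)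
  (hab4 : 4 < a + b) :
  exists2 o1 : nat -> R, o1 n @[n --> \oo] --> (0 : R) &
    \forall n \near \oo, forall sigma ell : 'I_n -> int,
      balanced_labeling delta sigma ell ->
      forall (d : measure_display) (T : measurableType d)
        (P : probability T R) (A : T -> 'M[bool]_n),
      PL_SBM P (a * ln n%:R / n%:R) (b * ln n%:R / n%:R) sigma A ->
      ('E_P [fun w => error_rate R sigma ell (simple_voting ell (A w))] <=
       (n%:R `^ (- ((1 + o1 n) *
                    (delta * (Num.sqrt a - Num.sqrt b) ^+ 2 / 2))))%:E)%E.
Proof.
exists (fun=> 0); first exact: cvg_cst.
have a0 : 0 < a by exact: lt_trans hab.
near=> n => sigma ell [sP lP _ [m1 mN1]] d T P A sbmA.
have n1 : 1 <= n%:R :> R by near: n; exact: nbhs_infty_ger.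
have n0 : 0 < n%:R :> R by exact: lt_le_trans n1.
have p01 : 0 <= a * ln n%:R / n%:R <= 1.
  by near: n; apply: log_rate_le1; exact: ltW.
have q01 : 0 <= b * ln n%:R / n%:R <= 1.
  by near: n; apply: log_rate_le1; exact: ltW.
pose t : R := ln (Num.sqrt a / Num.sqrt b).
have t0 : 0 <= t.
  by rewrite ln_ge0 // ler_pdivlMr ?sqrtr_gt0 // mul1r ler_wsqrtr // ltW.
have [_ mA _ _] := sbmA.
have mvote u : measurable [set w | simple_voting ell (A w) u != sigma u].
  exact: (measurable_row_event (fun f : 'I_n -> bool =>
    Num.sg (\sum_(v in fiber ell 1) (f v : nat)%:Z -
            \sum_(v in fiber ell (-1)) (f v : nat)%:Z) != sigma u)).
apply: expectation_error_rate_le; first exact: powR_ge0.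
- by move=> u; exact: mvote.
move=> u _.
pose c v : R := - (t * (sigma u * ell v)%:~R).
apply: (@le_trans _ _ (P [set w | (0 <= \sum_v c v * (A w u v)%:R)%R])).
  apply: le_measure; rewrite ?inE.
  - exact: mvote.
  - exact: (measurable_row_event (fun f : 'I_n -> bool =>
      0 <= \sum_v c v * (f v)%:R)).
  - by move=> w /=; exact: misvote_weighted_sum.
apply: le_trans (PL_SBM_chernoff u c p01 q01 sbmA) _.
rewrite lee_fin (vote_exponent _ _ _ _ sP lP m1 mN1) voting_exponent_opt //.
by rewrite addr0 mul1r /powR gt_eqF.
Unshelve. all: by end_near. Qed.
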